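(* If the matrix $A$ is balanced, then $\mathrm{gr}_I(R)$ is reduced.
   Context: Let $R=K[x_1,\ldots,x_n]$ be a polynomial ring over a field $K$, and let $I\subset R$ be an ideal of height $g\ge 2$ minimally generated by a finite set $F=\{x^{v_1},\ldots,x^{v_q}\}$ of square-free monomials of degree at least two (where $x^a=x_1^{a_1}\cdots x_n^{a_n}$). Each variable $x_i$ divides at least one monomial of $F$. $A$ is the $n\times q$ matrix with column vectors $v_1,\ldots,v_q$ (a $0/1$ matrix). $A$ is balanced if it has no square submatrix of odd order with exactly two $1$'s in each row and each column. $\mathrm{gr}_I(R)=R/I\oplus I/I^2\oplus I^2/I^3\oplus\cdots$ is the associated graded ring of $I$. A ring is reduced if $0$ is its only nilpotent element. *)

(* Defs.v *)
From HB Require Import structures.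
From mathcomp Require Import all_boot all_order all_algebra.
From mathcomp Require Import ring_quotient.
From mathcomp Require Import boolp.
From mathcomp Require Import mpoly.

Set Implicit Arguments.
Unset Strict Implicit.
Unset Printing Implicit Defensive.

Import GRing.Theory.
Local Open Scope ring_scope.

(* Ideals are boolean predicates, made total with the classical [`[< _ >]];   *)
(* [idealr R] is the library type of proper ideals of R.                      *)

Section Ideals.
Variable R : comNzRingType.

Definition ideal_gen (J : finType) (f : J -> R) (B : {set J}) : {pred R} :=
  fun p => `[< exists c : J -> R, p = \sum_(j in B) c j * f j >].

Definition minimally_generated (I : {pred R}) (J : finType) (f : J -> R) :=
  I =i ideal_gen f [set: J] /\
  forall B : {set J}, B \proper [set: J] -> ~ (I =i ideal_gen f B).

Definition ideal_mul (I1 I2 : {pred R}) : {pred R} :=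
  fun p => `[< exists s : seq (R * R),
    {in s, forall ab, ab.1 \in I1 /\ ab.2 \in I2} /\
    p = \sum_(ab <- s) ab.1 * ab.2 >].

Fixpoint ideal_exp (I : {pred R}) (k : nat) : {pred R} :=
  if k is k'.+1 then ideal_mul I (ideal_exp I k') else predT.

Definition prime_chain (P : prime_idealr R) (k : nat) :=
  exists c : nat -> prime_idealr R, c k =i P /\
    forall i, (i < k)%N ->
      {subset c i <= c i.+1} /\ ~ {subset c i.+1 <= c i}.

Definition prime_height (P : prime_idealr R) (h : nat) :=
  prime_chain P h /\ forall k, prime_chain P k -> (k <= h)%N.

(* Primes of infinite height satisfy no [prime_height P h], so they rightly   *)
(* play no role in the minimum.                                               *)
Definition ideal_height (I : {pred R}) (g : nat) :=
  (exists P : prime_idealr R, {subset I <= P} /\ prime_height P g) /\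
  forall (P : prime_idealr R) (h : nat),
    {subset I <= P} -> prime_height P h -> (g <= h)%N.

End Ideals.

Definition reduced (S : pzRingType) :=
  forall (x : S) (m : nat), x ^+ m = 0 -> x = 0.

(* The associated graded ring.  An element of the direct sum of the I^k is    *)
(* the polynomial p whose k-th coefficient is its component in I^k; products  *)
(* of homogeneous components are then those of {poly R}.  The ring gr_I(R) is *)
(* the quotient by the componentwise congruence modulo I^(k+1).               *)

Section AssociatedGradedRing.
Variables (R : comNzRingType) (I : idealr R).

Lemma ideal_exp0 k : 0 \in ideal_exp I k.
Proof.
case: k => [|k] //; apply/asboolP; exists [::].
by rewrite big_nil; split.
Qed.

Lemma ideal_expD k : {in ideal_exp I k &, forall x y, x + y \in ideal_exp I k}.
Proof.
case: k => [|k] // x y /asboolP [s [hs ->]] /asboolP [t [ht ->]].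
apply/asboolP; exists (s ++ t); rewrite big_cat; split=> // ab.
by rewrite mem_cat => /orP [/hs|/ht].
Qed.

Lemma ideal_exp_sum k (A : eqType) (s : seq A) (F : A -> R) :
  {in s, forall a, F a \in ideal_exp I k} ->
  \sum_(a <- s) F a \in ideal_exp I k.
Proof.
elim: s => [|a s IHs] h; first by rewrite big_nil ideal_exp0.
rewrite big_cons ideal_expD ?h ?mem_head //.
by apply: IHs => b bs; apply: h; rewrite inE bs orbT.
Qed.

Lemma ideal_expMl k a : {in ideal_exp I k, forall x, a * x \in ideal_exp I k}.
Proof.
case: k => [|k] // x /asboolP [s [hs ->]]; apply/asboolP.
exists [seq (a * ab.1, ab.2) | ab <- s]; split.
  by move=> _ /mapP [ab /hs [h1 h2] ->]; split=> //=; apply: idealMr.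
by rewrite big_map mulr_sumr; apply: eq_bigr => ab _; rewrite mulrA.
Qed.

Lemma ideal_expM j k x y : x \in ideal_exp I j -> y \in ideal_exp I k ->
  x * y \in ideal_exp I (j + k).
Proof.
elim: j x => [|j IHj] x; first by rewrite add0n => _; apply: ideal_expMl.
move=> /asboolP [s [hs ->]] hy; rewrite mulr_suml.
rewrite ideal_exp_sum // => ab /hs [h1 h2]; apply/asboolP.
exists [:: (ab.1, ab.2 * y)]; rewrite big_seq1 mulrA; split=> // _ /[!inE] /eqP ->.
by split=> //=; apply: IHj.
Qed.

Lemma ideal_exp1 : {subset ideal_exp I 1 <= I}.
Proof.
move=> _ /asboolP [s [hs ->]]; rewrite big_seq rpred_sum // => ab /hs [h _].
by rewrite mulrC; apply: idealMr.
Qed.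

Definition power_sum : {pred {poly R}} :=
  fun p => `[< forall k, p`_k \in ideal_exp I k >].

Lemma power_sum_subring : subring_closed power_sum.
Proof.
split.
- by apply/asboolP => -[|k]; rewrite coef1 ?ideal_exp0.
- move=> p q /asboolP hp /asboolP hq; apply/asboolP => k.
  by rewrite coefB ideal_expD // -mulN1r ideal_expMl.
move=> p q /asboolP hp /asboolP hq; apply/asboolP => k.
rewrite coefM ideal_exp_sum // => i _.
by rewrite -[k in ideal_exp I k](@subnKC i) ?ideal_expM // -ltnS ltn_ord.
Qed.

HB.instance Definition _ :=
  GRing.isSubringClosed.Build {poly R} power_sum power_sum_subring.

Record power_sum_ring := PowerSum {
  power_sum_val :> {poly R};
  _ : power_sum_val \in power_sum
}.

HB.instance Definition _ := [isSub for power_sum_val].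
HB.instance Definition _ := [Choice of power_sum_ring by <:].
HB.instance Definition _ :=
  [SubChoice_isSubComNzRing of power_sum_ring by <:].

Definition next_power_sum : {pred power_sum_ring} :=
  fun p => `[< forall k, (power_sum_val p)`_k \in ideal_exp I k.+1 >].

Lemma next_power_sum_idealr : idealr_closed next_power_sum.
Proof.
split.
- by apply/asboolP => k; rewrite coef0 ideal_exp0.
- apply/negP => /asboolP /(_ 0%N); rewrite coef1 => /ideal_exp1.
  by rewrite idealr1.
move=> a p q /asboolP hp /asboolP hq; apply/asboolP => k.
rewrite coefD ideal_expD // coefM ideal_exp_sum // => i _.
have /asboolP ha : power_sum_val a \in power_sum by exact: (valP a).
rewrite -[k in ideal_exp I k.+1](@subnKC i); last by rewrite -ltnS ltn_ord.
by rewrite -addnS ideal_expM.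
Qed.

HB.instance Definition _ :=
  isIdealr.Build power_sum_ring next_power_sum next_power_sum_idealr.

Definition gr : comNzRingType := {ideal_quot (next_power_sum : idealr _)}.

End AssociatedGradedRing.

(* Rows and columns are selected by injective maps; the condition does not    *)
(* depend on the order in which they are listed.                              *)
Definition balanced (n q : nat) (A : 'M[nat]_(n, q)) :=
  forall (k : nat) (f : 'I_k -> 'I_n) (h : 'I_k -> 'I_q),
    odd k -> injective f -> injective h ->
    let B := mxsub f h A in
    ~ ((forall i, #|[set j | B i j == 1%N]| = 2) /\
       (forall j, #|[set i | B i j == 1%N]| = 2)).

(* Main.v *)
Require Import Defs.
From mathcomp Require Import all_boot all_order all_algebra ring_quotient.
From mathcomp Require Import perm boolp generic_quotient zify ring lra.
From mathcomp Require Import mpoly.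

(** The columns of [A] are the edges of a hypergraph on the variables, and
    [x^m] lies in [I^k] exactly when [k] edges, repetitions allowed, pack into
    [m]: no variable [i] is used more than [m i] times ([mem_ideal_exp]).

    Reducedness is thereby a statement about packings.  If the class of [p] is
    a nonzero nilpotent, discard from each component [p_k] the monomials that
    already pack [k+1] edges; the rest is a nonzero representative [b].  Leading
    coefficients and leading monomials are multiplicative, so a power of [b]
    exhibits a monomial [m] of some [b_k] such that [l * m] packs [l * k + 1]
    edges for some [l >= 1] although [m] does not pack [k + 1] ([reduced_gr]).
    Dividing by [l] gives a fractional packing of [m] of value greater than [k],
    so it remains to show that, for balanced hypergraphs, a fractional packing
    of value greater than [k] yields an integral one of value [k + 1]
    ([integral_packing]).  This is the theorem of Fulkerson, Hoffman and
    Oppenheim, obtained in three steps.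

    - Colouring (Berge): every set of vertices of a balanced hypergraph can be
      coloured with [m + 1] colours so that each edge with more than [m] vertices
      meets all colours ([polychromatic_coloring]).  Two colours come from an
      induction on the vertices ([bicoloring]); for more, recolour two colour
      classes as long as this helps.

    - Integrality of covers: writing a fractional cover as [z / (m + 1)] and
      replacing vertex [i] by [z i] copies, the colour classes are [m + 1]
      integral covers, one of which is at most as heavy as the average
      ([exists_light_cover]).  By linear programming duality, in the form of
      Farkas' lemma, the maximum value of a fractional packing is therefore at
      least the minimum weight of an integral cover ([fractional_packing]).

    - Rounding: a fractional packing of value greater than [k - 1] forces all
      covers to weigh at least [k], hence can be improved to value [k].  Round
      one edge down, remove it together with what it consumes, and repeat; the
      value lost is less than 1, so the rest is again greater than an integer
      minus 1 and can be improved again ([integral_packing]). *)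

Set Implicit Arguments.
Unset Strict Implicit.
Unset Printing Implicit Defensive.

Import Order.TTheory GRing.Theory Num.Theory.
Local Open Scope ring_scope.

(** * Odd holes and bicolourings *)

(** The forbidden configurations of a balanced matrix, read as cyclic incidence
    patterns.  For [2 < k] the pattern makes [f] and [h] injective by itself,
    which is why the property is preserved when vertices are repeated. *)
Definition odd_hole_free (V E : finType) (inc : V -> E -> bool) :=
  forall (k : nat) (f : 'I_k -> V) (h : 'I_k -> E), odd k -> (2 < k)%N ->
    ~ (forall i j, inc (f i) (h j) = (i == j) || (i == ordS j)).

Lemma odd_hole_free_preim (V V' E : finType) (inc : V -> E -> bool)
    (p : V' -> V) :
  odd_hole_free inc -> odd_hole_free (fun x e => inc (p x) e).
Proof. by move=> Hinc k f h; apply: (Hinc k (p \o f)). Qed.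

(** A path that is as long as possible cannot be extended at its front without
    meeting itself. *)
Lemma exists_stuck_path (T : finType) (e : rel T) (x0 : T) :
  exists u p, [/\ path e u p, uniq (u :: p), last u p = x0 &
                  forall w, e w u -> w \in u :: p].
Proof.
suff ext d u p : path e u p -> uniq (u :: p) -> last u p = x0 ->
    (#|T| <= size p + d)%N ->
    exists u p, [/\ path e u p, uniq (u :: p), last u p = x0 &
                  forall w, e w u -> w \in u :: p].
  by apply: (ext #|T| x0 [::]).
elim: d u p => [|d IHd] u p ep Up lastp leTp.
  have := card_uniqP Up; have := max_card (mem (u :: p)).
  by rewrite addn0 in leTp; move=> le1 Eq; move: le1; rewrite Eq /= ltnNge leTp.
have [/existsP[w /andP[ewu w_p]]|/existsPn stuck] :=
  boolP [exists w, e w u && (w \notin u :: p)].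
  by apply: (IHd w (u :: p)); rewrite ?cons_uniq ?w_p ?[path _ _ _]/= ?ewu //=
    addSnnS.
exists u, p; split=> // w ewu; have := stuck w; rewrite ewu /=.
by rewrite negbK.
Qed.

Section Bicoloring.
Variables (V E : finType) (inc : V -> E -> bool).
Hypothesis Hinc : odd_hole_free inc.

Definition trace (S : {set V}) (e : E) := [set x in S | inc x e].

(** The graph formed by the edges whose trace on [S] has exactly two vertices:
    these are the edges that force two vertices to have distinct colours. *)
Definition link (S : {set V}) : rel V :=
  fun x y => (x != y) && [exists e, trace S e == [set x; y]].

Lemma linkP (S : {set V}) x y :
  link S x y -> x != y /\ exists e, trace S e = [set x; y].
Proof. by move=> /andP[-> /existsP[e /eqP Ee]]; split=> //; exists e. Qed.

Lemma link_in (S : {set V}) x y : link S x y -> (x \in S) && (y \in S).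
Proof.
move=> /linkP[_ [e Ee]].
have: x \in trace S e by rewrite Ee set21.
have: y \in trace S e by rewrite Ee set22.
by rewrite !inE => /andP[-> _] /andP[-> _].
Qed.

(** Since the traces of its edges on [S] have only two vertices, an odd cycle of
    links has no chords and is an odd hole. *)
Lemma no_odd_link_cycle (S : {set V}) (c : seq V) :
  uniq c -> cycle (link S) c -> odd (size c) -> (2 < size c)%N -> False.
Proof.
move=> Uc cyc oddc gt2.
have x0 : V by case: c gt2 {Uc cyc oddc}.
have c_next (j : 'I_(size c)) :
    link S (nth x0 c j) (nth x0 c (ordS j)).
  have cj : nth x0 c j \in c by rewrite mem_nth.
  have := next_cycle cyc cj; rewrite next_nth cj index_uniq //.
  case: c Uc cyc oddc gt2 j cj => //= y c Uc cyc oddc gt2 j cj.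
  have := ltn_ord j; rewrite ltnS leq_eqVlt => /orP[/eqP->|ltj].
    by rewrite modnn (nth_default y (leqnn _)).
  by rewrite /= modn_small //= (set_nth_default x0).
have /fin_all_exists[h hP] (j : 'I_(size c)) : exists e,
    trace S e = [set nth x0 c j; nth x0 c (ordS j)].
  by have [_] := linkP (c_next j).
apply: (Hinc (f := fun i : 'I_(size c) => nth x0 c i) (h := h) oddc gt2) => i j.
have iS : nth x0 c i \in S by have /andP[] := link_in (c_next i).
have -> : inc (nth x0 c i) (h j) = (nth x0 c i \in trace S (h j)).
  by rewrite inE iS.
by rewrite hP !inE !nth_uniq.
Qed.

(** Remove the first vertex [u] of a maximal path of links and colour the rest.
    Every link at [u] ends on the path, whose vertices alternate in colour; two
    differently coloured neighbours of [u] would close an odd cycle of links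
    through [u].  Hence the neighbours of [u] all have one colour, and [u] can
    be given the other. *)
Lemma bicoloring (S : {set V}) : exists f : V -> bool,
  forall e, (1 < #|trace S e|)%N ->
    exists x y, [/\ x \in trace S e, y \in trace S e & f x != f y].
Proof.
elim: {S}_.+1 {-2}S (ltnSn #|S|) => // N IHN S; rewrite ltnS => leSN.
have [->|[x0 x0S]] := set_0Vmem S.
  exists xpredT => e; suff -> : trace set0 e = set0 by rewrite cards0.
  by apply/setP=> x; rewrite !inE.
have [u [p [pathp Up lastp stuck]]] := exists_stuck_path (link S) x0.
have uS : u \in S.
  case: p pathp lastp {Up stuck} => [_ /= -> //|w p /andP[/link_in/andP[] //]].
have [|f fP] := IHN (S :\ u).
  by move: leSN; rewrite (cardsD1 u S) uS add1n; apply: leq_trans.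
have trD1 e : trace (S :\ u) e = trace S e :\ u.
  by apply/setP=> x; rewrite !inE andbA.
have alt x y : x != u -> y != u -> link S x y -> f y = ~~ f x.
  move=> xu yu /linkP[xy [e Ee]].
  have Ee' : trace (S :\ u) e = [set x; y].
    rewrite trD1 Ee; apply/setP=> z; rewrite !inE.
    by case: eqP => // ->; rewrite !(eq_sym u) (negPf xu) (negPf yu).
  have [|a [b []]] := fP e; first by rewrite Ee' cards2 xy.
  by rewrite Ee' !inE => /orP[]/eqP-> /orP[]/eqP->; rewrite ?eqxx //;
    case: (f x) (f y) => [] [].
have altp x s : x != u -> u \notin s -> path (link S) x s ->
    f (last x s) = f x (+) odd (size s).
  elim: s x => [|y s IHs] x xu /=; first by rewrite addbF.
  rewrite inE negb_or => /andP[uy us] /andP[xy ys].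
  rewrite IHs // 1?eq_sym // (alt x y) // 1?eq_sym //.
  by case: (f x) (odd _) => [] [].
pose w := head u p.
exists (fun x => if x == u then ~~ f w else f x) => e gt1.
have [gt1'|le1] := ltnP 1 #|trace (S :\ u) e|.
  have [a [b []]] := fP e gt1'; rewrite trD1 !inE => /andP[au ae] /andP[bu be].
  by exists a, b; rewrite !inE ae be (negPf au) (negPf bu).
move: gt1; rewrite (cardsD1 u) -trD1.
case ue: (u \in trace S e); last by rewrite add0n ltnNge le1.
rewrite add1n ltnS => gt0.
have /eqP/cards1P[z Ez] : #|trace (S :\ u) e| = 1%N.
  by apply/eqP; rewrite eqn_leq le1.
have /setD1P[zu ze] : z \in trace S e :\ u by rewrite -trD1 Ez set11.
exists u, z; rewrite ue ze eqxx (negPf zu); split=> //.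
suff -> : f w = f z by case: (f z).
have luz : link S z u.
  rewrite /link zu; apply/existsP; exists e.
  by rewrite -(setD1K ue) -trD1 Ez setUC.
have zp : z \in p by have := stuck z luz; rewrite inE (negPf zu).
apply/eqP/negPn/negP => fwz.
have [p1 [p2 Ep]] : exists p1 p2, p = rcons p1 z ++ p2.
  by case/path.splitP: zp => p1 p2; exists p1, p2.
have [s Es] : exists s, rcons p1 z = w :: s.
  by rewrite /w Ep; case: (p1) => [|y p1'] /=; [exists [::]|exists (rcons p1' z)].
have lastz : last w s = z.
  by have := last_rcons w p1 z; rewrite Es /=.
move: pathp Up; rewrite Ep Es cat_path -cat_cons cat_uniq.
move=> /andP[/= /andP[uw ws] _] /andP[Uc _].
have [uws _] := andP Uc; move: uws; rewrite inE negb_or => /andP[nuw nus].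
(* An even number of steps from [w] to [z] would give them the same colour. *)
have odds : odd (size s).
  move: fwz; rewrite -lastz altp // 1?eq_sym //.
  by case: (odd _) => //; rewrite addbF eqxx.
apply: (@no_odd_link_cycle S (u :: w :: s)) => //=.
- by rewrite uw rcons_path ws lastz.
- by rewrite negbK.
- by case: (s) odds.
Qed.

(** Choose [f] to maximize the total number of colours seen by the edges.  If an
    edge [e0] with more than [m] vertices misses the colour [q], some colour [p]
    occurs twice in it; a bicolouring of the vertices coloured [p] or [q] does not
    decrease the count of any edge and increases that of [e0]. *)
Lemma polychromatic_coloring (S : {set V}) (m : nat) :
  exists f : V -> 'I_m.+1, forall e, (m < #|trace S e|)%N ->
    forall c, exists2 x, x \in trace S e & f x = c.
Proof.
pose Phi (f : {ffun V -> 'I_m.+1}) := (\sum_e #|f @: trace S e|)%N.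
have [f _ fmax] := @arg_maxnP _ [ffun=> ord0] predT Phi isT.
exists f => e0 gtm q.
have [/imsetP[x xe ->]|qf] := boolP (q \in f @: trace S e0); first by exists x.
exfalso.
have [x [y [xe ye xy fxy]]] : exists x y,
    [/\ x \in trace S e0, y \in trace S e0, x != y & f x = f y].
  have : ~~ [forall x in trace S e0, forall y in trace S e0,
              (f x == f y) ==> (x == y)].
    apply: contraL gtm => inj; rewrite -leqNgt.
    have injf : {in trace S e0 &, injective f}.
      move=> x y xe ye fxy; move: inj => /forall_inP/(_ x xe).
      by move=> /forall_inP/(_ y ye); rewrite fxy eqxx => /eqP.
    rewrite -(card_in_imset injf) -ltnS -[X in (_ < X)%N]card_ord.
    by apply: proper_card; apply/properP; split; [apply/subsetP|exists q].
  rewrite negb_forall_in => /exists_inP[x xe].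
  rewrite negb_forall_in => /exists_inP[y ye].
  by rewrite negb_imply => /andP[/eqP fxy xy]; exists x, y.
pose p := f x.
have pq : p != q by apply: contraNneq qf => <-; apply: imset_f.
pose T := [set x in S | (f x == p) || (f x == q)].
have [g gP] := bicoloring T.
pose f' := [ffun x => if x \in T then (if g x then p else q) else f x].
have trTS e : trace T e \subset trace S e.
  by apply/subsetP=> z; rewrite !inE => /andP[/andP[-> _] ->].
have sub e : (1 < #|trace T e|)%N ->
    f @: trace S e :|: [set p; q] \subset f' @: trace S e.
  move=> /gP[a [b [ae be gab]]].
  have aT : a \in T by move: ae; rewrite inE => /andP[].
  have bT : b \in T by move: be; rewrite inE => /andP[].
  have [aS bS] := (subsetP (trTS e) _ ae, subsetP (trTS e) _ be).
  have pI : [set p; q] \subset f' @: trace S e.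
    apply/subsetP=> c; rewrite !inE => cpq; apply/imsetP.
    move: gab cpq; case ga: (g a); case gb: (g b) => //= _ /orP[]/eqP->;
    by [exists a => //; rewrite ffunE aT ga | exists b => //; rewrite ffunE bT gb].
  rewrite subUset pI andbT; apply/subsetP=> _ /imsetP[z ze ->].
  have [zT|zT] := boolP (z \in T); last first.
    by apply/imsetP; exists z => //; rewrite ffunE (negPf zT).
  by apply: (subsetP pI); move: zT; rewrite !inE => /andP[].
have le e : (#|f @: trace S e| <= #|f' @: trace S e|)%N.
  have [gt1|le1] := ltnP 1 #|trace T e|.
    by apply: leq_trans (subset_leq_card (sub e gt1)); apply/subset_leq_card/subsetUl.
  (* An edge with at most one recoloured vertex: on it, recolouring amounts to
     a permutation of the colours. *)
  have [s sP] : exists s : {perm 'I_m.+1},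
      forall z, z \in trace S e -> f' z = s (f z).
    have notT z : z \in trace S e -> z \notin trace T e ->
        [/\ f' z = f z, p != f z & q != f z].
      rewrite !inE => /andP[zS ze]; rewrite zS ze /= andbT => zT.
      rewrite ffunE inE zS /= (negPf zT); move: zT; rewrite negb_or.
      by rewrite ![_ == f z]eq_sym => /andP[].
    have [T0|[z zT]] := set_0Vmem (trace T e).
      exists 1%g => z ze; rewrite perm1.
      by have [|->] := notT z ze; rewrite ?T0 ?inE.
    have ET : trace T e = [set z].
      by apply/eqP; rewrite eq_sym eqEcard sub1set zT cards1.
    exists (tperm (f z) (f' z)) => y' ye'.
    have [->|y'z] := eqVneq y' z; first by rewrite tpermL.
    have [|-> pf qf'] := notT y' ye'; first by rewrite ET inE.
    have zinT : z \in T by move: zT; rewrite inE => /andP[].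
    have fz : (f z == p) || (f z == q) by move: zinT; rewrite inE => /andP[].
    rewrite tpermD //; first by case/orP: fz => /eqP->.
    by rewrite ffunE zinT; case: (g z).
  have -> : f' @: trace S e = s @: (f @: trace S e).
    by rewrite -imset_comp; apply: eq_in_imset.
  by rewrite (card_imset _ (@perm_inj _ s)).
have : (Phi f' <= Phi f)%N by exact: fmax.
rewrite leqNgt => /negP; apply.
rewrite /Phi (bigD1 e0) //= [X in (_ < X)%N](bigD1 e0) //= -addSn leq_add //;
  last by apply: leq_sum.
have gt1 : (1 < #|trace T e0|)%N.
  have sub2 : [set x; y] \subset trace T e0.
    apply/subsetP=> z; rewrite !inE => /orP[]/eqP->; rewrite -?fxy eqxx /=.
      by move: xe; rewrite !inE => /andP[-> ->].
    by move: ye; rewrite !inE => /andP[-> ->].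
  by apply: leq_trans (subset_leq_card sub2); rewrite cards2 xy.
apply: proper_card; apply: proper_sub_trans (sub e0 gt1).
by apply/properP; split; [apply: subsetUl | exists q => //; rewrite !inE eqxx !orbT].
Qed.

End Bicoloring.

(** * Farkas' lemma *)

Lemma exists_between (F : realFieldType) (I : finType) (P Q : pred I)
    (l u : I -> F) :
  (forall p q, P p -> Q q -> l p <= u q) ->
  exists t, (forall p, P p -> l p <= t) /\ (forall q, Q q -> t <= u q).
Proof.
move=> lu; case: (pickP P) => [p0 Pp0|P0].
  have [p Pp pmax] := arg_maxP l Pp0.
  by exists (l p); split=> [p' /pmax //|q]; apply: lu.
case: (pickP Q) => [q0 Qq0|Q0].
  have [q Qq qmin] := arg_minP u Qq0.
  by exists (u q); split=> [p|q' /qmin //]; rewrite P0.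
by exists 0; split=> [p|q]; rewrite ?P0 ?Q0.
Qed.

Lemma sum_delta (F : pzRingType) (I : finType) (i : I) (g : I -> F) :
  \sum_k (i == k)%:R * g k = g i.
Proof.
rewrite (bigD1 i) //= eqxx mul1r big1 ?addr0 // => k ki.
by rewrite eq_sym (negPf ki) mul0r.
Qed.

(** Fourier-Motzkin elimination of the unknowns [y j], one [j] in [S] at a time:
    each derived inequality is a nonnegative combination of the given ones, so a
    certificate of infeasibility for the derived system pulls back. *)
Lemma farkas (F : realFieldType) (J : finType) (S : {set J}) (I : finType)
    (A : I -> J -> F) (c : I -> F) :
  (exists y : J -> F, forall i, 0 <= c i + \sum_(j in S) A i j * y j) \/
  (exists w : I -> F, [/\ forall i, 0 <= w i,
     forall j, j \in S -> \sum_i w i * A i j = 0 & \sum_i w i * c i < 0]).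
Proof.
elim: {S}_.+1 {-2}S (ltnSn #|S|) I A c => // N IHN S; rewrite ltnS => leSN I A c.
have [->|[j0 j0S]] := set_0Vmem S.
  case: (pickP (fun i => c i < 0)) => [i0 ci0|c_ge0]; [right|left].
    exists (fun i => (i0 == i)%:R); split=> [i|j|]; rewrite ?inE //.
      by rewrite sum_delta.
  exists (fun=> 0) => i; rewrite big_set0 addr0 leNgt.
  by have := c_ge0 i => /= ->.
(* The inequalities after elimination of [y j0]: those not involving it, and a
   combination of each lower bound on it with each upper bound.  Indices that
   correspond to neither get the trivial inequality. *)
pose M (r : I + I * I) : I -> F := match r with
  | inl i => fun k => if A i j0 == 0 then (i == k)%:R else 0
  | inr (p, q) => fun k => if (0 < A p j0) && (A q j0 < 0)
      then - A q j0 * (p == k)%:R + A p j0 * (q == k)%:R else 0 end.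
have M_ge0 r k : 0 <= M r k.
  case: r => [i|[p q]] /=; case: ifP => //.
  by case/andP=> Ap Aq; rewrite addr_ge0 ?mulr_ge0 ?ler0n // ?oppr_ge0 ltW.
have M_inl i g : A i j0 = 0 -> \sum_k M (inl i) k * g k = g i.
  by move=> Ai; rewrite /= Ai eqxx sum_delta.
have M_inr p q g : 0 < A p j0 -> A q j0 < 0 ->
    \sum_k M (inr (p, q)) k * g k = - A q j0 * g p + A p j0 * g q.
  move=> Ap Aq; rewrite /= Ap Aq /= -(sum_delta p g) -(sum_delta q g).
  by rewrite !mulr_sumr -big_split /=; apply: eq_bigr => k _; rewrite mulrDl !mulrA.
have M_j0 r : \sum_k M r k * A k j0 = 0.
  case: r => [i|[p q]].
    have [Ai|Ai] := eqVneq (A i j0) 0; first by rewrite M_inl.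
    by rewrite big1 // => k _ /=; rewrite (negPf Ai) mul0r.
  have [/andP[Ap Aq]|pq] := boolP ((0 < A p j0) && (A q j0 < 0)).
    by rewrite M_inr //; ring.
  by rewrite big1 // => k _ /=; rewrite (negPf pq) mul0r.
have ltS : (#|S :\ j0| < N)%N.
  by move: leSN; rewrite (cardsD1 j0 S) j0S.
have [[y yP]|[w [w_ge0 wA wc]]] := IHN (S :\ j0) ltS _
  (fun r j => \sum_k M r k * A k j) (fun r => \sum_k M r k * c k); last first.
  right; exists (fun k => \sum_r w r * M r k).
  have swap g : \sum_k (\sum_r w r * M r k) * g k
              = \sum_r w r * (\sum_k M r k * g k).
    under eq_bigr do rewrite mulr_suml.
    rewrite exchange_big /=; apply: eq_bigr => r _.
    by rewrite mulr_sumr; apply: eq_bigr => k _; rewrite mulrA.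
  split=> [k|j jS|]; rewrite ?swap //.
    by apply: sumr_ge0 => r _; rewrite mulr_ge0.
  have [->|jj0] := eqVneq j j0; first by apply: big1 => r _; rewrite M_j0 mulr0.
  by apply: wA; rewrite !inE jj0.
left; pose L k := c k + \sum_(j in S :\ j0) A k j * y j.
have {}yP r : 0 <= \sum_k M r k * L k.
  apply: le_trans (yP r) _; rewrite le_eqVlt; apply/orP; left; apply/eqP.
  under [in RHS]eq_bigr do rewrite /L mulrDr mulr_sumr.
  rewrite big_split /= exchange_big /=; congr (_ + _); apply: eq_bigr => j _.
  by rewrite mulr_suml; apply: eq_bigr => k _; rewrite mulrA.
(* Solvability of the derived system says that every lower bound on [y j0] is
   below every upper bound. *)
have [|t [tl tu]] := @exists_between _ _ (fun p => 0 < A p j0)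
    (fun q => A q j0 < 0) (fun p => - L p / A p j0) (fun q => L q / - A q j0).
  move=> p q Ap Aq; rewrite ler_pdivrMr // mulrAC ler_pdivlMr ?oppr_gt0 //.
  by have := yP (inr (p, q)); rewrite M_inr //; lra.
exists (fun j => if j == j0 then t else y j) => i.
have -> : c i + \sum_(j in S) A i j * (if j == j0 then t else y j)
        = L i + A i j0 * t.
  rewrite (big_setD1 _ j0S) /= eqxx /L -addrA [X in _ = _ + X]addrC.
  congr (_ + (_ + _)); apply: eq_bigr => j.
  by rewrite !inE => /andP[/negPf-> _].
have [Ai|Ai|Ai] := ltgtP (A i j0) 0.
- have := tu i Ai; rewrite ler_pdivlMr ?oppr_gt0 //; lra.
- have := tl i Ai; rewrite ler_pdivrMr //; lra.
- by have := yP (inl i); rewrite M_inl // Ai mul0r addr0.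
Qed.

Lemma common_denominator (I : finType) (x : I -> rat) :
  (forall i, 0 <= x i) ->
  exists (d : nat) (z : I -> nat), forall i, x i * d.+1%:R = (z i)%:R.
Proof.
move=> x_ge0; pose D := (\prod_i `|denq (x i)|)%N.
have D_gt0 : (0 < D)%N by rewrite prodn_gt0 // => i; rewrite absz_gt0.
exists D.-1; rewrite prednK //.
exists (fun i => `|numq (x i)| * \prod_(k | k != i) `|denq (x k)|)%N => i.
rewrite /D (bigD1 i) //= !natrM mulrA; congr (_ * _).
rewrite -{1}(divq_num_den (x i)).
have -> : (`|denq (x i)|%N%:R : rat) = (denq (x i))%:~R.
  by rewrite pmulrn absz_denq.
have -> : (`|numq (x i)|%N%:R : rat) = (numq (x i))%:~R.
  by rewrite pmulrn gez0_abs // numq_ge0.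
by rewrite divfK // intr_eq0 denq_neq0.
Qed.

(** * Integral covers and packings *)

(** Integrality of the covering polyhedron: [z / (m + 1)] is a fractional cover
    of the edges in [D], and some integral cover weighs no more. *)
Lemma exists_light_cover (V E : finType) (inc : V -> E -> bool)
    (D : {set E}) (z a : V -> nat) (m : nat) :
  odd_hole_free inc ->
  (forall e, e \in D -> m < \sum_(i | inc i e) z i)%N ->
  exists C : {set V}, (forall e, e \in D -> exists2 i, i \in C & inc i e) /\
    (m.+1 * \sum_(i in C) a i <= \sum_i z i * a i)%N.
Proof.
move=> Hinc zP; pose W := {i : V & 'I_(z i)}.
have [f fP] := polychromatic_coloring
  (odd_hole_free_preim (p := fun x : W => tag x) Hinc) [set: W] m.
pose C c := [set tag x | x in [set x : W | f x == c]].
have [c _ cmin] := @arg_minnP _ ord0 predT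
  (fun c : 'I_m.+1 => (\sum_(i in C c) a i)%N) isT.
exists (C c); split=> [e eD|].
  have [|x] := fP e _ c.
    apply: leq_trans (zP e eD) _; rewrite -sum1_card.
    have -> : (\sum_(i | inc i e) z i = \sum_(i | inc i e) \sum_(j < z i) 1)%N.
      by apply: eq_bigr => i _; rewrite sum1_card card_ord.
    rewrite (sig_big_dep _ (fun i (j : 'I_(z i)) => true) (fun _ _ => 1%N)) /=.
    by apply/eq_leq/eq_bigl => x; rewrite !inE andbT.
  rewrite !inE /= => xe fx; exists (tag x) => //.
  by apply/imsetP; exists x; rewrite ?inE ?fx.
have -> : (\sum_i z i * a i = \sum_(x : W) a (tag x))%N.
  under eq_bigr => i _.
    have -> : (z i * a i = \sum_(j < z i) a i)%N by rewrite sum_nat_const card_ord.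
  over.
  exact: (sig_big_dep _ (fun i (j : 'I_(z i)) => true) (fun i _ => a i)).
rewrite (partition_big f predT) //=.
rewrite -[m.+1 in leqLHS]card_ord -sum_nat_const; apply: leq_sum => c' _.
apply: leq_trans (cmin c' isT) _.
rewrite (eq_bigl (fun x => x \in [set x : W | f x == c'])) => [|x]; last by rewrite inE.
rewrite (partition_big_imset (fun x : W => tag x)) /=.
apply: leq_sum => _ /imsetP[x xc ->].
by rewrite (bigD1 x) ?xc ?eqxx //= leq_addr.
Qed.

Section Packing.
Variables (V E : finType) (inc : V -> E -> bool).
Hypothesis Hinc : odd_hole_free inc.

Definition covers (D : {set E}) (C : {set V}) :=
  forall e, e \in D -> exists2 i, i \in C & inc i e.

(** Duality: a Farkas certificate against a packing of value [k] is, up to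
    scaling, a fractional cover of weight less than [k], and
    [exists_light_cover] turns it into an integral one. *)
Lemma fractional_packing (D : {set E}) (a : V -> nat) (k : nat) :
  (forall C, covers D C -> k <= \sum_(i in C) a i)%N ->
  exists y : E -> rat, [/\ forall e, 0 <= y e,
    forall i, \sum_(e in D | inc i e) y e <= (a i)%:R
    & k%:R <= \sum_(e in D) y e].
Proof.
move=> Ck.
(* The constraints: capacity at each vertex, nonnegativity, and value at least
   [k]. *)
pose A (r : V + (E + 'I_1)) (e : E) : rat := match r with
  | inl i => - (inc i e)%:R
  | inr (inl e') => (e' == e)%:R
  | inr (inr _) => 1 end.
pose c (r : V + (E + 'I_1)) : rat := match r with
  | inl i => (a i)%:R
  | inr (inl e') => 0
  | inr (inr _) => - k%:R end.
have [[y yP]|[w [w_ge0 wA wc]]] := farkas D A c.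
  exists (fun e => if e \in D then y e else 0); split=> [e|i|].
  - case: ifP => // eD; have := yP (inr (inl e)); rewrite /= add0r.
    rewrite (bigD1 e) //= eqxx mul1r big1 ?addr0 // => e' /andP[_ /negPf e'e].
    by rewrite eq_sym e'e mul0r.
  - suff Ei : - \sum_(e in D | inc i e) (if e \in D then y e else 0)
            = \sum_(e in D) A (inl i) e * y e.
      by rewrite -subr_ge0 Ei; apply: (yP (inl i)).
    rewrite big_mkcondr -sumrN; apply: eq_bigr => e eD /=; rewrite eD.
    by case: (inc i e); rewrite ?mulN1r // oppr0 mul0r.
  - have := yP (inr (inr ord0)); rewrite /= addrC subr_ge0 => /le_trans; apply.
    rewrite le_eqVlt; apply/orP; left; apply/eqP.
    by apply: eq_bigr => e ->; rewrite mul1r.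
exfalso.
have [d [z zP]] := common_denominator w_ge0.
pose T := z (inr (inr ord0)).
have sum_w g : (\sum_i w i * g i) * d.+1%:R = \sum_i (z (inl i))%:R * g (inl i)
    + (\sum_e (z (inr (inl e)))%:R * g (inr (inl e)) + T%:R * g (inr (inr ord0))).
  rewrite mulr_suml !big_sumType big_ord1 /=; congr (_ + (_ + _)).
  - by apply: eq_bigr => i _; rewrite mulrAC zP.
  - by apply: eq_bigr => i _; rewrite mulrAC zP.
  - by rewrite mulrAC zP.
have ltT : (\sum_i z (inl i) * a i < T * k)%N.
  move: wc; rewrite -(pmulr_llt0 _ (ltr0Sn _ d)) sum_w /=.
  rewrite [X in _ + (X + _)]big1 ?add0r => [|e _]; last by rewrite mulr0.
  rewrite mulrN subr_lt0 -natrM -(ltr_nat rat) => /le_lt_trans -> //.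
  by rewrite natr_sum ler_sum // => i _; rewrite natrM.
have leT e : e \in D -> (T <= \sum_(i | inc i e) z (inl i))%N.
  move=> eD; have := sum_w (A^~ e); rewrite wA // mul0r /= mulr1 => /esym/eqP.
  rewrite addr_eq0 => /eqP Ee.
  rewrite -(ler_nat rat) -[leRHS]opprK natr_sum -sumrN big_mkcond /=.
  have -> : \sum_i (if inc i e then - (z (inl i))%:R else 0 : rat)
          = \sum_i (z (inl i))%:R * - (inc i e)%:R.
    by apply: eq_bigr => i _; case: (inc i e); rewrite ?mulrN1 // oppr0 mulr0.
  rewrite Ee opprK lerDr; apply: sumr_ge0 => e' _.
  by rewrite mulr_ge0 ?ler0n.
(* The multiplier [T] of the value constraint is positive because the weights
   [a] are nonnegative; dividing by it gives the fractional cover. *)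
case ET: T => [|m] in ltT leT; first by rewrite mul0n in ltT.
have [C [Ccov Cle]] := exists_light_cover a Hinc leT.
have := leq_ltn_trans Cle ltT; rewrite ltn_pmul2l // ltnNge.
by rewrite Ck.
Qed.

(** Induction on the number of edges.  The strict inequality in the hypothesis,
    rather than [k <= \sum y], is what makes the induction go through: rounding
    [y e0] down costs less than 1. *)
Lemma integral_packing (D : {set E}) (a : V -> nat) (k : nat) (y : E -> rat) :
  (forall e, 0 <= y e) ->
  (forall i, \sum_(e in D | inc i e) y e <= (a i)%:R) ->
  k%:R < \sum_(e in D) y e + 1 ->
  exists w : E -> nat, (forall i, \sum_(e in D | inc i e) w e <= a i)%N /\
    (k <= \sum_(e in D) w e)%N.
Proof.
elim: {D}_.+1 {-2}D (ltnSn #|D|) a k y => // N IHN D.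
rewrite ltnS => leDN a k y0 y0_ge0 y0a ky0.
have [D0|[e0 e0D]] := set_0Vmem D.
  exists (fun=> 0%N); rewrite D0 big_set0; split=> [i|].
    by rewrite big1.
  by move: ky0; rewrite D0 big_set0 add0r ltrn1 ltnS leqn0 => /eqP->.
(* Weak duality: [y0] shows that every cover weighs more than [k - 1], hence at
   least [k]. *)
have [|y [y_ge0 ya ky]] := @fractional_packing D a k.
  move=> C Ccov; rewrite -ltnS -(ltr_nat rat); apply: lt_le_trans ky0 _.
  rewrite -natr1 lerD2r natr_sum.
  apply: le_trans (ler_sum _ (fun i _ => y0a i)).
  rewrite (exchange_big_dep (mem D)) /=; last by move=> i e _ /andP[].
  apply: ler_sum => e eD; have [i iC ie] := Ccov e eD.
  rewrite (bigD1 i) /= ?iC ?eD // lerDl.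
  by apply: sumr_ge0.
pose b := Num.truncn (y e0).
have /andP[leb ltb] : b%:R <= y e0 < b.+1%:R by apply: truncn_itv.
have sumD (R : nmodType) (f : E -> R) (P : pred E) :
  \sum_(e in D | P e) f e = (if P e0 then f e0 else 0) + \sum_(e in D :\ e0 | P e) f e.
  by rewrite !big_mkcondr (big_setD1 _ e0D).
have lebi i : inc i e0 -> (b <= a i)%N.
  move=> ie; rewrite -(ler_nat rat); apply: le_trans leb _.
  apply: le_trans (ya i); rewrite sumD ie lerDl.
  by apply: sumr_ge0.
have [||||w [wa kw]] := IHN (D :\ e0) _ (fun i => if inc i e0 then a i - b else a i)%N
  (k - b)%N y => //.
- by move: leDN; rewrite (cardsD1 e0 D) e0D.
- move=> i; have := ya i; rewrite sumD; case: ifP => [ie|_]; last by rewrite add0r.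
  by rewrite natrB ?lebi //; lra.
- have [kb|/ltnW bk] := leqP k b.
    have -> : (k - b = 0)%N by apply/eqP.
    by rewrite ltr_wpDl // sumr_ge0.
  move: ky; rewrite natrB // (big_setD1 _ e0D) /=; rewrite -natr1 in ltb; lra.
exists (fun e => if e == e0 then b else w e).
have wD1 (P : pred E) : (\sum_(e in D :\ e0 | P e) (if e == e0 then b else w e)
    = \sum_(e in D :\ e0 | P e) w e)%N.
  by apply: eq_bigr => e; rewrite !inE => /andP[/andP[/negPf-> _] _].
split=> [i|].
  rewrite (sumD nat) wD1 eqxx; have := wa i; have := lebi i.
  by case: ifP => // _ /(_ isT) leb'; rewrite -(leq_add2l b) subnKC.
have := sumD nat (fun e => if e == e0 then b else w e) predT.
rewrite wD1 eqxx !big_mkcondr /= => ->.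
by rewrite -leq_subLR.
Qed.

End Packing.

(** * From balanced matrices to hypergraphs *)

Lemma val_ordS k (i : 'I_k) : ordS i = (if i.+1 == k then 0 else i.+1) :> nat.
Proof.
have := ltn_ord i; rewrite /= leq_eqVlt; case: eqVneq => [->|_ /= ltik].
  by rewrite modnn.
by rewrite modn_small.
Qed.

Lemma balanced_odd_hole_free n q (A : 'M[nat]_(n, q)) :
  balanced A -> odd_hole_free (fun i j => A i j == 1%N).
Proof.
move=> balA k f h oddk k_gt2 hole.
have ordS_neq (i : 'I_k) : i != ordS i.
  apply/eqP => /(congr1 (@nat_of_ord k)); rewrite val_ordS; case: eqP; lia.
have ordSS_neq (i : 'I_k) : i != ordS (ordS i).
  apply/eqP => /(congr1 (@nat_of_ord k)); rewrite !val_ordS.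
  by have := ltn_ord i; do 2!case: eqP; lia.
have injf : injective f.
  move=> i i' fi; have := hole i' i; rewrite -fi hole eqxx.
  move=> /esym/orP[/eqP-> //|/eqP E1]; have := hole i i'; rewrite fi hole eqxx.
  move=> /esym/orP[/eqP //|/eqP E2].
  by have := ordSS_neq i; rewrite -E1 -E2 eqxx.
have injh : injective h.
  move=> j j' hj; have := hole j j'; rewrite -hj hole eqxx.
  move=> /esym/orP[/eqP //|/eqP E1]; have := hole j' j; rewrite hj hole eqxx.
  move=> /esym/orP[/eqP-> //|/eqP E2].
  by have := ordSS_neq j; rewrite -E2 -E1 eqxx.
apply: (balA k f h oddk injf injh); split=> [i|j].
  have -> : [set j | mxsub f h A i j == 1%N] = [set i; ord_pred i].
    apply/setP=> j; rewrite !inE mxE hole eq_sym; congr (_ || _).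
    by rewrite -[RHS](can_eq (@ordSK k)) ord_predK eq_sym.
  by rewrite cards2 -(can_eq (@ordSK k)) ord_predK eq_sym ordS_neq.
have -> : [set i | mxsub f h A i j == 1%N] = [set j; ordS j].
  by apply/setP=> i; rewrite !inE mxE hole.
by rewrite cards2 ordS_neq.
Qed.


(** * Powers of a monomial ideal and the associated graded ring *)

Lemma gr_reduced (R : comNzRingType) (I : idealr R) :
  (forall (p : power_sum_ring I) l,
     p ^+ l.+1 \in @next_power_sum R I -> p \in @next_power_sum R I) ->
  reduced (gr I).
Proof.
move=> H x [|l]; first by rewrite expr0 => e10; rewrite -[x]mulr1 e10 mulr0.
pose Q := {ideal_quot (@next_power_sum R I : idealr _)}.
have pi0 (p : power_sum_ring I) : (\pi_Q%qT p == 0) = (p \in @next_power_sum R I).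
  by rewrite -(rmorph0 (\pi_Q%qT)) -Quotient.idealrBE subr0.
elim/quotW: x => p.
rewrite -[X in X ^+ _]/(\pi_Q%qT p) -rmorphXn => /eqP; rewrite pi0 => /H.
by rewrite -pi0 => /eqP.
Qed.

Section EdgeIdeal.
Variables (K : fieldType) (n q : nat) (v : 'I_q -> 'X_{1..n}).

(** At least [k], rather than exactly [k], edges, so that sums of packings are
    packings without discarding edges. *)
Definition packs (k : nat) (m : 'X_{1..n}) :=
  exists w : 'I_q -> nat,
    (k <= \sum_j w j)%N /\ forall i, (\sum_j w j * v j i <= m i)%N.

Lemma packs0 m : packs 0 m.
Proof. by exists (fun=> 0%N); split=> // i; rewrite big1. Qed.

Lemma packs1 j m : (v j <= m)%MM -> packs 1 m.
Proof.
move=> /mnm_lepP le; exists (fun l => (j == l)%:R%N); split=> [|i].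
  by rewrite (bigD1 j) //= eqxx leq_addr.
rewrite (bigD1 j) //= eqxx mul1n big1 ?addn0 ?le // => l lj.
by rewrite eq_sym (negPf lj).
Qed.

Lemma packsD k l m m' : packs k m -> packs l m' -> packs (k + l) (m + m')%MM.
Proof.
move=> [w [kw wm]] [w' [kw' wm']]; exists (fun j => w j + w' j)%N; split=> [|i].
  by rewrite big_split leq_add.
rewrite mnmDE; under eq_bigr do rewrite mulnDl.
by rewrite big_split leq_add.
Qed.

Lemma packsS k m : packs k.+1 m ->
  exists2 j, (v j <= m)%MM & packs k (m - v j)%MM.
Proof.
move=> [w [kw wm]].
have [j wj] : exists j, (0 < w j)%N.
  apply/existsP; apply: contraLR kw; rewrite negb_exists => /forallP w0.
  by rewrite big1 // => j _; apply/eqP; rewrite -leqn0 leqNgt w0.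
have vm : (v j <= m)%MM.
  apply/mnm_lepP => i; apply: leq_trans (wm i); rewrite (bigD1 j) //=.
  by rewrite -[X in (X <= _)%N]mul1n (leq_trans _ (leq_addr _ _)) // leq_mul2r wj orbT.
exists j => //; (* Remove one copy of an edge [j] that is used. *)
exists (fun l => w l - (l == j))%N; split=> [|i].
  move: kw; rewrite !(bigD1 j (P := predT)) //= eqxx.
  under [X in _ -> (_ <= _ + X)%N]eq_bigr => l /negPf-> do rewrite subn0.
  by lia.
rewrite mnmBE leq_subRL; last by move/mnm_lepP: vm.
apply: leq_trans (wm i); rewrite !(bigD1 j (P := predT)) //= eqxx addnA.
under eq_bigr => l /negPf-> do rewrite subn0.
by rewrite leq_add2r -[X in (X + _)%N]mul1n -mulnDl leq_mul2r subnKC ?leqnn ?orbT.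
Qed.

Variable I : idealr {mpoly K[n]}.
Hypothesis Igen : I =i ideal_gen (fun j => 'X_[v j] : {mpoly K[n]}) [set: 'I_q].

Lemma msupp_ideal_exp k (p : {mpoly K[n]}) m :
  p \in ideal_exp I k -> m \in msupp p -> packs k m.
Proof.
have sum_packs l (T : eqType) (s : seq T) (F : T -> {mpoly K[n]}) :
    (forall t m, t \in s -> m \in msupp (F t) -> packs l m) ->
    forall m, m \in msupp (\sum_(t <- s) F t) -> packs l m.
  move=> HF m' /msupp_sum_le /flatten_mapP[t].
  by rewrite mem_filter => /andP[_ ts]; apply: HF.
have I_packs b m' : b \in I -> m' \in msupp b -> packs 1 m'.
  rewrite Igen => /asboolP[c ->].
  rewrite (eq_bigl predT) => [|j]; last by rewrite inE.
  apply: sum_packs => j m'' _ /msuppM_le /allpairsP[[m1 m2] /= [_]].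
  rewrite msuppX inE => /eqP-> ->; apply: (@packs1 j).
  by apply/mnm_lepP => i; rewrite mnmDE leq_addl.
elim: k p m => [|k IHk] p m; first by move=> _ _; apply: packs0.
move=> /asboolP[s [sP ->]]; apply: sum_packs => -[a b] m' /sP /= [aI bI].
move=> /msuppM_le /allpairsP[[m1 m2] /= [m1a m2b ->]].
by rewrite -add1n; apply: packsD; [apply: (I_packs a)|apply: (IHk b)].
Qed.

Lemma mpolyX_ideal_exp k m : packs k m -> ('X_[m] : {mpoly K[n]}) \in ideal_exp I k.
Proof.
elim: k m => [//|k IHk] m /packsS[j vm /IHk mk].
apply/asboolP; exists [:: ('X_[v j], 'X_[m - v j])].
rewrite big_seq1 /= -mpolyXD addmC submK //; split=> // ab.
rewrite inE => /eqP-> /=; split=> //; rewrite Igen; apply/asboolP.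
exists (fun l => (j == l)%:R); rewrite (eq_bigl predT) => [|l]; last by rewrite inE.
rewrite (bigD1 j) //= eqxx mul1r big1 ?addr0 // => l lj.
by rewrite eq_sym (negPf lj) mul0r.
Qed.

Lemma mem_ideal_exp k (p : {mpoly K[n]}) :
  reflect (forall m, m \in msupp p -> packs k m) (p \in ideal_exp I k).
Proof.
apply: (iffP idP) => [pI m|pk]; first exact: msupp_ideal_exp.
rewrite [p]mpolyE; apply: ideal_exp_sum => m mp.
by rewrite -mul_mpolyC; apply/ideal_expMl/mpolyX_ideal_exp/pk.
Qed.

(** A monomial [m] of [p_k] counts for the class of [p] only if it does not pack
    [k + 1] edges.  Keeping just these monomials, the class is represented by a
    polynomial [b] whose top coefficient, if nonzero, has a leading monomial that
    violates the descent hypothesis. *)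
Lemma reduced_gr :
  (forall k l m, packs (l.+1 * k).+1 (m *+ l.+1)%MM -> packs k.+1 m) ->
  reduced (gr I).
Proof.
move=> descent; apply: gr_reduced => p l pl.
pose bad k (r : {mpoly K[n]}) :=
  \sum_(m <- msupp r | ~~ `[< packs k.+1 m >]) r@_m *: 'X_[m].
have badE k r m : (bad k r)@_m = if `[< packs k.+1 m >] then 0 else r@_m.
  rewrite /bad [r in RHS]mpolyE !raddf_sum /= big_mkcond /=.
  case: ifP => mk; [apply: big1_seq|apply: eq_bigr] => m' => [_|_];
    rewrite !mcoeffZ !mcoeffX; case: eqVneq => [->|_]; rewrite ?mk ?mulr0 //=;
    by case: ifP => _; rewrite ?mcoeff0 // mcoeffZ mcoeffX; case: eqVneq.
pose b : {poly {mpoly K[n]}} := \poly_(k < size (val p)) bad k (val p)`_k.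
have bE k m : b`_k@_m = if `[< packs k.+1 m >] then 0 else (val p)`_k@_m.
  rewrite coef_poly; case: ltnP => [_|/(nth_default 0)->]; first exact: badE.
  by rewrite mcoeff0 if_same.
have b_ps : b \in power_sum I.
  apply/asboolP => k; apply/mem_ideal_exp => m; rewrite mcoeff_msupp bE.
  case: ifP => [|_]; first by rewrite eqxx.
  have /asboolP/(_ k)/mem_ideal_exp := valP p; move=> pk pm; apply: pk.
  by rewrite mcoeff_msupp.
pose pb : power_sum_ring I := PowerSum b_ps.
have p_pb : p - pb \in @next_power_sum _ I.
  apply/asboolP => k; rewrite coefB; apply/mem_ideal_exp => m.
  rewrite mcoeff_msupp mcoeffB bE; case: ifP => [/asboolP //|_].
  by rewrite subrr eqxx.
suff b0 : b = 0.
  have -> : p = p - pb; last by [].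
  by rewrite [pb](_ : _ = 0) ?subr0 //; apply: val_inj.
apply: contraTeq isT => b_neq0.
have : pb ^+ l.+1 \in @next_power_sum _ I.
  rewrite -[_ ^+ _](subKr (p ^+ l.+1)); rewrite rpredB // subrXX mulrC.
  exact: idealMr.
move/asboolP/(_ (l.+1 * (size b).-1)%N).
have -> : power_sum_val (pb ^+ l.+1) = b ^+ l.+1 by exact: (rmorphXn val).
rewrite mulnC -size_exp -lead_coefE lead_coef_exp => /mem_ideal_exp.
have lc_neq0 : lead_coef b != 0 by rewrite lead_coef_eq0.
move/(_ (mlead (lead_coef b) *+ l.+1)%MM).
rewrite -mleadX // mlead_supp ?expf_neq0 // => /(_ isT).
rewrite mleadX // size_exp. rewrite mulnC => /descent pk.
have := mlead_supp lc_neq0; rewrite mcoeff_msupp lead_coefE bE.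
by case: asboolP => //; rewrite eqxx.
Qed.
End EdgeIdeal.

(** A packing of [(l + 1) m] by [(l + 1) k + 1] edges, divided by [l + 1], is a
    fractional packing of [m] of value greater than [k]. *)
Lemma packs_descent n q (v : 'I_q -> 'X_{1..n}) k l m :
  (forall j i, v j i <= 1)%N -> odd_hole_free (fun i j => v j i == 1%N) ->
  packs v (l.+1 * k).+1 (m *+ l.+1)%MM -> packs v k.+1 m.
Proof.
move=> v01 Hv [w [kw wm]].
have sum_v (R : pzSemiRingType) (f : 'I_q -> R) i :
    \sum_(j in [set: 'I_q] | v j i == 1%N) f j = \sum_j f j * (v j i)%:R.
  rewrite [RHS]big_mkcond [LHS]big_mkcond /=; apply: eq_bigr => j _.
  rewrite inE /=; case: (v j i) (v01 j i) => [|[|]] //=; rewrite ?mulr0 ?mulr1 //.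
have sumT (R : nmodType) (f : 'I_q -> R) :
    \sum_(j in [set: 'I_q]) f j = \sum_j f j.
  by apply: eq_bigl => j; rewrite inE.
have [|i||u [um ku]] := @integral_packing _ _ _ Hv [set: 'I_q] m k.+1
  (fun j => (w j)%:R / l.+1%:R).
- by move=> j; rewrite divr_ge0 ?ler0n.
- rewrite -mulr_suml ler_pdivrMr ?ltr0Sn // sum_v.
  under eq_bigr do rewrite -natrM.
  by rewrite -natr_sum -natrM ler_nat -mulmnE.
- rewrite sumT -mulr_suml -natr1 ltrD2r ltr_pdivlMr ?ltr0Sn // -natr_sum.
  by rewrite -natrM ltr_nat mulnC.
exists u; split=> [|i]; first by rewrite -(sumT nat).
apply: leq_trans (um i); rewrite (sum_v nat) leq_eqVlt; apply/orP; left.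
by apply/eqP; apply: eq_bigr => j _; rewrite natn.
Qed.

Theorem proposition4p10 (K : fieldType) (n q g : nat)
    (v : 'I_q -> 'X_{1..n}) (I : idealr {mpoly K[n]})
    (Igen : minimally_generated I (fun j : 'I_q => 'X_[v j] : {mpoly K[n]}))
    (v_squarefree : forall j i, (v j i <= 1)%N)
    (v_deg : forall j, (2 <= mdeg (v j))%N)
    (I_height : ideal_height I g) (g_ge2 : (2 <= g)%N)
    (x_divides : forall i : 'I_n, exists j : 'I_q, (0 < v j i)%N) :
  balanced (\matrix_(i < n, j < q) v j i) -> reduced (gr I).
Proof.
move=> balA; apply: (reduced_gr (proj1 Igen)) => k l m; apply: packs_descent => //.
move=> c f h oddc c_gt2 hole; apply: (balanced_odd_hole_free balA oddc c_gt2) => i j.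
by rewrite mxE; apply: hole.
Qed.
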